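(* Let $T>0$, $\mu\ge0$, $s>0$, $x_0\in\mathbb{R}^n$, and let $f:\mathbb{R}^n\to\mathbb{R}$ be continuously differentiable, $\mu$-strongly convex (possibly $\mu=0$) and $(1/s)$-smooth. Let $X:[0,T]\to\mathbb{R}^n$ be the solution to the unified NAG-G ODE $$\ddot X+\left(\frac{\sqrt\mu}{2}\tanh\left(\frac{\sqrt\mu}{2}(T-t)\right)+\frac{3}{T-t}\operatorname{cothc}\left(\frac{\sqrt\mu}{2}(T-t)\right)\right)\dot X+\nabla f(X)=0$$ with $X(0)=x_0$, $\dot X(0)=0$. Then the function $$\begin{aligned}\mathcal{E}(t)={}&\frac{4}{(T-t)^2}\operatorname{cschc}^2\left(\frac{\sqrt\mu}{2}(T-t)\right)\left(f(X(t))-f(X(T))\right)\\&-\frac{8}{(T-t)^4}\operatorname{cschc}^4\left(\frac{\sqrt\mu}{2}(T-t)\right)\|X(t)-X(T)\|^2\\&+\frac{8}{(T-t)^4}\operatorname{cschc}^2\left(\frac{\sqrt\mu}{2}(T-t)\right)\operatorname{cothc}^2\left(\frac{\sqrt\mu}{2}(T-t)\right)\left\|X(t)+\frac{T-t}{2}\operatorname{tanhc}\left(\frac{\sqrt\mu}{2}(T-t)\right)\dot X(t)-X(T)\right\|^2\end{aligned}$$ is monotonically decreasing (non-increasing) on $[0,T)$.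
   Context: $\operatorname{sinhc}(x)=\sinh(x)/x$ for $x\ne0$, $\operatorname{sinhc}(0)=1$; $\operatorname{tanhc}(x)=\operatorname{sinhc}(x)/\cosh(x)$; $\operatorname{cothc}(x)=1/\operatorname{tanhc}(x)$; $\operatorname{cschc}(x)=1/\operatorname{sinhc}(x)$. $f$ is $\mu$-strongly convex if $f(y)\ge f(x)+\langle\nabla f(x),y-x\rangle+\frac{\mu}{2}\|y-x\|^2$ for all $x,y$; $f$ is $L$-smooth if $\nabla f$ is $L$-Lipschitz. $f$ is assumed to have a minimizer $x^*$. The ODE holds on $[0,T)$, where the solution is unique; the solution is extended continuously to $t=T$, and $X(T)$ denotes the value of this extension (with $\dot X(T)=0$ and $\ddot X(T)=\lim_{t\to T^-}\frac{\dot X(t)}{t-T}=\frac12\nabla f(X(T))$). *)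

(* Defs.v *)
From HB Require Import structures.
From mathcomp Require Import all_boot all_order all_algebra.
From mathcomp Require Import all_classical all_reals all_analysis.

Set Implicit Arguments.
Unset Strict Implicit.
Unset Printing Implicit Defensive.

Import Order.TTheory GRing.Theory Num.Theory.
Import numFieldNormedType.Exports.

Local Open Scope classical_set_scope.
Local Open Scope ring_scope.

Section Hyperbolic.
Context {R : realType}.
Implicit Type x : R.

Definition sinh x : R := (expR x - expR (- x)) / 2.
Definition cosh x : R := (expR x + expR (- x)) / 2.
Definition tanh x : R := sinh x / cosh x.

Definition sinhc x : R := if x == 0 then 1 else sinh x / x.
Definition tanhc x : R := sinhc x / cosh x.
Definition cothc x : R := (tanhc x)^-1.
Definition cschc x : R := (sinhc x)^-1.

End Hyperbolic.

Section Euclidean.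
Context {R : realType} {n : nat}.
Implicit Types u v x : 'rV[R]_n.

(* The library norm `|u| on 'rV[R]_n is the sup norm: it induces the usual
   topology, but the metric hypotheses need the Euclidean norm. *)
Definition dot u v : R := \sum_(i < n) u 0 i * v 0 i.
Definition enorm u : R := Num.sqrt (dot u u).

Definition grad (f : 'rV[R]_n -> R) x : 'rV[R]_n :=
  \row_(i < n) 'D_(delta_mx 0 i) f x.

Definition continuously_differentiable (f : 'rV[R]_n -> R) : Prop :=
  (forall x, differentiable f x) /\ continuous (grad f).

Definition strongly_convex (mu : R) (f : 'rV[R]_n -> R) : Prop :=
  forall x y,
    f x + dot (grad f x) (y - x) + mu / 2 * enorm (y - x) ^+ 2 <= f y.

Definition smooth (L : R) (f : 'rV[R]_n -> R) : Prop :=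
  forall x y, enorm (grad f x - grad f y) <= L * enorm (x - y).

End Euclidean.

(* Derivative relative to a set A, i.e., the limit of the difference quotients
   over u in A, u != t. At interior points of A it is the usual derivative; for
   A = [0, T[ and t = 0 it is the right derivative. It is only meaningful when
   t is a limit point of A. *)
Section RelativeDerivative.
Context {R : realType} {V : normedModType R}.
Implicit Types (A : set R) (g : R -> V) (t : R).

Definition derivable_within A g t : Prop :=
  cvg ((u - t)^-1 *: (g u - g t) @[u --> within A t^']).

Definition derive_within A g t : V :=
  lim ((u - t)^-1 *: (g u - g t) @[u --> within A t^']).

End RelativeDerivative.

Section UnifiedNAGG.
Context {R : realType} {n : nat}.
Variables (T mu : R) (f : 'rV[R]_n -> R) (X : R -> 'rV[R]_n).

Definition velocity : R -> 'rV[R]_n := derive_within `[0, T[ X.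
Definition acceleration : R -> 'rV[R]_n := derive_within `[0, T[ velocity.

Definition nagg_damping (t : R) : R :=
  Num.sqrt mu / 2 * tanh (Num.sqrt mu / 2 * (T - t))
  + 3 / (T - t) * cothc (Num.sqrt mu / 2 * (T - t)).

(* X solves the differential equation on [0, T[, and X T is the value of its
   continuous extension to [0, T]; values of X outside [0, T] are irrelevant. *)
Record nagg_solution (x0 : 'rV[R]_n) : Prop := NaggSolution {
  nagg_continuous : {within `[0, T], continuous X};
  nagg_derivable : forall t : R, 0 <= t < T -> derivable_within `[0, T[ X t;
  nagg_derivable2 :
    forall t : R, 0 <= t < T -> derivable_within `[0, T[ velocity t;
  nagg_ode : forall t : R, 0 <= t < T ->
    acceleration t + nagg_damping t *: velocity t + grad f (X t) = 0;
  nagg_position0 : X 0 = x0;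
  nagg_velocity0 : velocity 0 = 0
}.

Definition nagg_energy (t : R) : R :=
  let z := Num.sqrt mu / 2 * (T - t) in
  4 / (T - t) ^+ 2 * cschc z ^+ 2 * (f (X t) - f (X T))
  - 8 / (T - t) ^+ 4 * cschc z ^+ 4 * enorm (X t - X T) ^+ 2
  + 8 / (T - t) ^+ 4 * cschc z ^+ 2 * cothc z ^+ 2
    * enorm (X t + ((T - t) / 2 * tanhc z) *: velocity t - X T) ^+ 2.

End UnifiedNAGG.

(* Main.v *)
Require Import Defs.
From HB Require Import structures.
From mathcomp Require Import all_boot all_order all_algebra.
From mathcomp Require Import all_classical all_reals all_analysis.
From mathcomp Require Import ring lra.

Set Implicit Arguments.
Unset Strict Implicit.
Unset Printing Implicit Defensive.

Import Order.TTheory GRing.Theory Num.Theory.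
Import numFieldNormedType.Exports.

Local Open Scope classical_set_scope.
Local Open Scope ring_scope.

(** Write k for half the square root of mu and put a(t) = sinh(k (T - t)) / k
(read as T - t when k = 0) and c(t) = cosh(k (T - t)), so that a' = - c,
c' = - k^2 a, c^2 - k^2 a^2 = 1 and mu = 4 k^2.  With Y = X - X(T), V = X' and
w = f(X) - f(X(T)), every hyperbolic factor of the energy is a rational function
of a and c; expanding the last square, the two |Y|^2 terms combine, because
c^2 - 1 = k^2 a^2, and the energy becomes

  (2 / a^2) (2 w + mu |Y|^2 + 4 (c / a) <Y, V> + |V|^2)

([nagg_energyE]).  In the same variables the damping coefficient is
k^2 a / c + 3 c / a ([nagg_dampingE]).  Differentiating and substituting the
equation of motion for V', the terms in <grad f(X), V> cancel, and so do those
in <Y, V>, which leaves ([is_derive_energy_form])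

  8 (c / a^3) (w - <grad f(X), Y> + (mu / 2) |Y|^2) - 4 (k^2 / (a c)) |V|^2.

The first bracket is nonpositive: it is strong convexity of f between the points
X(t) and X(T).  So the derivative is nonpositive on ]0, T[, and continuity of
the energy on [0, T[ carries monotonicity down to the left endpoint. *)

(** * Derivatives relative to a set *)

Section RelativeDerivativeTheory.
Context {R : realType} {V : normedModType R}.
Implicit Types (A : set R) (g : R -> V) (t : R).

(** The difference g u - g t is (u - t) times a difference quotient that
converges, hence tends to 0; the puncture at t costs nothing since the
difference vanishes there. *)
Lemma derivable_within_cvg A g t : derivable_within A g t ->
  g u @[u --> within A (nbhs t)] --> g t.
Proof.
move=> /cvg_ex[/= l gl].
have id0 : (u - t) @[u --> within A t^'] --> (0 : R).
  rewrite -(subrr t); apply: cvgB; last exact: cvg_cst.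
  by apply: cvg_within_filter; apply: cvg_within_filter; exact: cvg_id.
have /cvgrPdist_lt g0 :
    (u - t) *: ((u - t)^-1 *: (g u - g t)) @[u --> within A t^'] --> (0 : V).
  by rewrite -(scale0r l); exact: cvgZ.
apply/cvgrPdist_lt => e e0; have := g0 _ e0.
rewrite !near_withinE; apply: filterS => u + Au.
have [->|ut] := eqVneq u t; first by move=> _; rewrite subrr normr0.
move=> /(_ isT Au); rewrite sub0r normrN scalerA divff ?subr_eq0//.
by rewrite scale1r distrC.
Qed.

(** When A is a neighborhood of t, restricting the punctured neighborhoods of t
to A does not change the filter, so the relative derivative is the limit of the
usual difference quotients, up to the shift u = h + t. *)
Lemma is_derive_within A g t : nbhs t A -> derivable_within A g t ->
  is_derive t 1 g (derive_within A g t).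
Proof.
move=> tA; have AE : within A t^' = t^'.
  apply/seteqP; split=> P tP; last first.
    change (\forall u \near t^', A u -> P u).
    by apply: filterS (tP : \forall u \near t^', P u) => u Pu _.
  change (\forall u \near t, u != t -> P u).
  have {}tP : \forall u \near t, u != t -> A u -> P u := tP.
  by apply: filterS2 tA tP => u Au /[swap] ut; apply.
rewrite /derivable_within /derive_within AE => /cvg_ex[/= l gl].
have shift_dnbhs : (h + t) @[h --> 0^'] --> t^'.
  move=> P tP; change (\forall h \near 0, h != 0 -> P (h + t)).
  have : \forall u \near t, u != t -> P u := tP.
  rewrite (near_shift 0) subr0; apply: filterS => h /= hP h0.
  by apply: hP; rewrite -subr_eq0 addrK.
have gl' : h^-1 *: ((g \o shift t) (h *: 1) - g t) @[h --> 0^'] --> l.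
  apply: cvg_trans (cvg_comp _ _ shift_dnbhs gl).
  apply: near_eq_cvg; apply: filterE => h.
  by rewrite /= addrK [h *: 1]mulr1.
split; first by apply/cvg_ex; exists l.
by rewrite /derive (cvg_lim _ gl')// (cvg_lim _ gl).
Qed.

End RelativeDerivativeTheory.

(** * Euclidean inner product and gradient *)

Section EuclideanTheory.
Context {R : realType} {n : nat}.
Implicit Types (u v w : 'rV[R]_n) (Y V : R -> 'rV[R]_n).

Lemma dotC u v : dot u v = dot v u.
Proof. by apply: eq_bigr => i _; rewrite mulrC. Qed.

Lemma dotDr u v w : dot u (v + w) = dot u v + dot u w.
Proof. by rewrite -big_split; apply: eq_bigr => i _; rewrite mxE mulrDr. Qed.

Lemma dotZr k u v : dot u (k *: v) = k * dot u v.
Proof. by rewrite mulr_sumr; apply: eq_bigr => i _; rewrite mxE mulrCA. Qed.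

Lemma dot_addZ k u v :
  dot (u + k *: v) (u + k *: v) =
  dot u u + 2 * (k * dot u v) + k ^+ 2 * dot v v.
Proof.
rewrite dotDr dotZr ![dot (_ + _) _]dotC !dotDr !dotZr [dot v u]dotC.
ring.
Qed.

Lemma enorm_sqr u : enorm u ^+ 2 = dot u u.
Proof. by rewrite sqr_sqrtr// sumr_ge0// => i _; rewrite -expr2 sqr_ge0. Qed.

Lemma is_derive_dot Y V (t : R) dY dV :
  is_derive t 1 Y dY -> is_derive t 1 V dV ->
  is_derive t 1 (fun r => dot (Y r) (V r)) (dot dY (V t) + dot (Y t) dV).
Proof.
have coord (Z : R -> 'rV[R]_n) dZ i : is_derive t 1 Z dZ ->
    is_derive t 1 (fun r => Z r 0 i : R) (dZ 0 i).
  move=> -[Zt <-]; split; first by move/derivable_mxP: Zt; exact.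
  by rewrite derive_mx// mxE.
move=> DY DV.
have -> : (fun r => dot (Y r) (V r)) =
    \sum_(i < n) ((fun r => Y r 0 i) * (fun r => V r 0 i)).
  by apply/funext => r; rewrite fct_sumE.
have D i := is_deriveM (coord _ _ i DY) (coord _ _ i DV).
apply: is_derive_eq (is_derive_sum D) _.
rewrite -big_split; apply: eq_bigr => i _ /=.
by rewrite addrC; congr (_ + _); rewrite [_ *: _]mulrC.
Qed.

Lemma cvg_dot (F : set_system R) {FF : Filter F} Y V (y v : 'rV[R]_n) :
  Y @ F --> y -> V @ F --> v -> dot (Y r) (V r) @[r --> F] --> dot y v.
Proof.
have coord (Z : R -> 'rV[R]_n) (z : 'rV[R]_n) i :
    Z @ F --> z -> (Z r 0 i : R) @[r --> F] --> (z 0 i : R).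
  move=> Zz; apply: (@continuous_cvg _ _ _ F FF Z (fun M => M 0 i) z _ Zz).
  exact: coord_continuous.
move=> Yy Vv; apply: cvg_big => //; first exact: add_continuous.
move=> i _; apply: cvgM; exact: coord.
Qed.

(** Chain rule: by linearity of the differential, its value on dY is the sum of
the partial derivatives weighted by the coordinates of dY. *)
Lemma is_derive_comp_grad (f : 'rV[R]_n -> R) Y (t : R) dY :
  differentiable f (Y t) -> is_derive t 1 Y dY ->
  is_derive t 1 (f \o Y) (dot (grad f (Y t)) dY).
Proof.
move=> df [/derivable1_diffP DY <-].
have dfY : differentiable (f \o Y) t by exact: differentiable_comp.
split; first exact: diff_derivable.
rewrite deriveE// diff_comp//= deriveE// {1}['d Y t 1]row_sum_delta.
rewrite linear_sum; apply: eq_bigr => i _.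
by rewrite linearZ mxE deriveE// mulrC.
Qed.

End EuclideanTheory.

(** * Hyperbolic functions *)

Section HyperbolicTheory.
Context {R : realType}.
Implicit Types x k : R.

Lemma cosh_gt0 x : 0 < cosh x.
Proof. by rewrite divr_gt0// addr_gt0// expR_gt0. Qed.

Lemma cosh2_sinh2 x : cosh x ^+ 2 - sinh x ^+ 2 = 1.
Proof.
have := expRxMexpNx_1 x; rewrite /cosh /sinh => e1.
by field: e1.
Qed.

Lemma sinhcE x : sinhc x * x = sinh x.
Proof.
rewrite /sinhc; case: eqVneq => [->|x0]; last by rewrite divfK.
by rewrite mulr0 /sinh oppr0 subrr mul0r.
Qed.

Lemma sinhc_gt0 x : 0 < sinhc x.
Proof.
rewrite /sinhc /sinh; case: (ltgtP x 0) => // x0; last first.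
  by rewrite divr_gt0// divr_gt0// subr_gt0 ltr_expR; lra.
rewrite -mulrNN -invrN divr_gt0// ?oppr_gt0// pmulr_llt0// subr_lt0.
rewrite ltr_expR; lra.
Qed.

Lemma is_derive_expRN x : is_derive x 1 (fun y => expR (- y)) (- expR (- x)).
Proof.
have D := is_derive1_comp (is_derive_expR (- x)) (is_deriveNid x 1).
apply: is_derive_eq D _.
by rewrite mulrN1.
Qed.

Lemma is_derive_sinh x : is_derive x 1 sinh (cosh x).
Proof.
have D := is_deriveB (is_derive_expR x) (is_derive_expRN x).
have -> : @sinh R = 2^-1 \*: (expR - (fun y => expR (- y))).
  by apply/funext => y; exact: mulrC.
by apply: is_derive_eq; rewrite opprK [_ *: _]mulrC.
Qed.

Lemma is_derive_cosh x : is_derive x 1 cosh (sinh x).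
Proof.
have D := is_deriveD (is_derive_expR x) (is_derive_expRN x).
have -> : @cosh R = 2^-1 \*: (expR + (fun y => expR (- y))).
  by apply/funext => y; exact: mulrC.
by apply: is_derive_eq; rewrite [_ *: _]mulrC.
Qed.

Lemma is_derive_mulr k x : is_derive x 1 ( *%R k) k.
Proof.
apply: is_derive_eq (is_deriveZ k (is_derive_id x 1)) _.
by rewrite [_ *: _]mulr1.
Qed.

(** The solutions of y'' = k^2 y with initial data (0, 1) and (1, 0): for k != 0
the first one is sinh (k x) / k, and writing it with sinhc covers k = 0 too. *)
Definition ssinh k x : R := x * sinhc (k * x).
Definition scosh k x : R := cosh (k * x).

Lemma ssinh_gt0 k x : 0 < x -> 0 < ssinh k x.
Proof. by move=> x0; rewrite mulr_gt0// sinhc_gt0. Qed.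

Lemma mul_ssinh k x : k * ssinh k x = sinh (k * x).
Proof. by rewrite /ssinh mulrA mulrC sinhcE. Qed.

Lemma scosh2_ssinh2 k x : scosh k x ^+ 2 - k ^+ 2 * ssinh k x ^+ 2 = 1.
Proof. by rewrite -exprMn mul_ssinh cosh2_sinh2. Qed.

(** For k != 0 this is the chain rule for sinh (k x) / k; for k = 0 the function
is the identity and scosh is constantly 1. *)
Lemma is_derive_ssinh k x : is_derive x 1 (ssinh k) (scosh k x).
Proof.
have [->|k0] := eqVneq k 0.
  have -> : ssinh 0 = id.
    by apply/funext => y; rewrite /ssinh mul0r /sinhc eqxx mulr1.
  by apply: is_derive_eq; rewrite /scosh mul0r /cosh oppr0 expR0; field.
have -> : ssinh k = k^-1 \*: (sinh \o ( *%R k)).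
  by apply/funext => y; rewrite /= -mul_ssinh [_ *: _]mulKf.
have D := is_derive_sinh (k * x).
have Dk := is_derive_mulr k x.
by apply: is_derive_eq; rewrite [_ *: _]mulrC mulfK.
Qed.

Lemma is_derive_scosh k x : is_derive x 1 (scosh k) (k ^+ 2 * ssinh k x).
Proof.
have D := is_derive_cosh (k * x).
have Dk := is_derive_mulr k x.
apply: is_derive_eq (is_derive1_comp D Dk) _.
by rewrite -mul_ssinh; ring.
Qed.

End HyperbolicTheory.

(** * The energy in reduced variables *)

Section EnergyForm.
Context {R : realType}.

(** The energy in reduced variables, to be used with w = f(X) - f(X(T)),
q = |Y|^2, p = <Y, V> and v = |V|^2. *)
Definition energy_form (mu a c w q p v : R) : R :=
  2 * a^-1 ^+ 2 * (2 * w + mu * q + 4 * (c * a^-1 * p) + v).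

(** The hypotheses are the derivatives of w, q, p, v along a solution of
V' = - d V - g, with gV and gY standing for <g, V> and <g, Y>.  The cancellation
is a rational identity: up to the outer factor 2 / a^2, the coefficient of gV
is 2 - 2 and that of p is
8 k^2 - 4 (k^2 + 3 c^2 / a^2) + 4 (c^2 / a^2 - k^2) + 8 c^2 / a^2 = 0. *)
Lemma is_derive_energy_form (k t gV gY : R) (a c w q p v : R -> R) :
  let d := k ^+ 2 * a t / c t + 3 * c t / a t in
  a t != 0 -> c t != 0 ->
  is_derive t 1 a (- c t) -> is_derive t 1 c (- (k ^+ 2 * a t)) ->
  is_derive t 1 w gV -> is_derive t 1 q (2 * p t) ->
  is_derive t 1 p (v t - d * p t - gY) ->
  is_derive t 1 v (- 2 * (d * v t + gV)) ->
  is_derive t 1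
    (fun u => energy_form (4 * k ^+ 2) (a u) (c u) (w u) (q u) (p u) (v u))
    (8 * c t / a t ^+ 3 * (w t - gY + 2 * k ^+ 2 * q t)
     - 4 * k ^+ 2 / (a t * c t) * v t).
Proof.
move=> d a0 c0 Da Dc Dw Dq Dp Dv.
have DD (g h : R -> R) dg dh : is_derive t 1 g dg -> is_derive t 1 h dh ->
    is_derive t 1 (fun u => g u + h u) (dg + dh).
  exact: is_deriveD.
have DM (g h : R -> R) dg dh : is_derive t 1 g dg -> is_derive t 1 h dh ->
    is_derive t 1 (fun u => g u * h u) (g t * dh + h t * dg).
  exact: is_deriveM.
have DZ (l : R) (g : R -> R) dg : is_derive t 1 g dg ->
    is_derive t 1 (fun u => l * g u) (l * dg).
  exact: is_deriveZ.
have Di : is_derive t 1 (fun u => (a u)^-1) (c t / a t ^+ 2).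
  by apply: is_derive_eq (is_deriveV a0 Da) _;
    rewrite scaleNr scalerN opprK mulrC.
have Dpre := DZ 2 _ _ (DM _ _ _ _ Di Di).
have Dform := DD _ _ _ _ (DD _ _ _ _ (DD _ _ _ _ (DZ 2 _ _ Dw)
  (DZ (4 * k ^+ 2) _ _ Dq)) (DZ 4 _ _ (DM _ _ _ _ (DM _ _ _ _ Dc Di) Dp))) Dv.
apply: is_derive_eq (DM _ _ _ _ Dpre Dform) _.
rewrite /d; field.
by rewrite a0 c0.
Qed.

Lemma cvg_energy_form (F : set_system R) {FF : Filter F}
    (mu a0 c0 w0 q0 p0 v0 : R) (a c w q p v : R -> R) :
  a0 != 0 -> a @ F --> a0 -> c @ F --> c0 -> w @ F --> w0 -> q @ F --> q0 ->
  p @ F --> p0 -> v @ F --> v0 ->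
  energy_form mu (a u) (c u) (w u) (q u) (p u) (v u) @[u --> F] -->
    energy_form mu a0 c0 w0 q0 p0 v0.
Proof.
move=> a00 Ca Cc Cw Cq Cp Cv.
have Ci : (a u)^-1 @[u --> F] --> a0^-1 by exact: cvgV.
have Ci2 : (a u)^-1 ^+ 2 @[u --> F] --> a0^-1 ^+ 2 by exact: cvgM.
apply: cvgM; first by apply: cvgM => //; exact: cvg_cst.
apply: cvgD => //; apply: cvgD; last first.
  by apply: cvgM; [exact: cvg_cst|apply: cvgM => //; exact: cvgM].
by apply: cvgD; apply: cvgM => //; exact: cvg_cst.
Qed.

End EnergyForm.

(** * Reduction of the equation and of the energy *)

Section Nagg.
Context {R : realType} {n : nat}.
Implicit Types T mu t : R.

Lemma sqr_half_sqrt mu : 0 <= mu -> mu = 4 * (Num.sqrt mu / 2) ^+ 2.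
Proof. by move=> mu0; rewrite expr_div_n sqr_sqrtr//; field. Qed.

Lemma nagg_dampingE T mu t : t < T ->
  let k := Num.sqrt mu / 2 in
  nagg_damping T mu t = k ^+ 2 * ssinh k (T - t) / scosh k (T - t)
                        + 3 * scosh k (T - t) / ssinh k (T - t).
Proof.
move=> tT k; have T_t : T - t != 0 by rewrite subr_eq0 gt_eqF.
have c0 := lt0r_neq0 (cosh_gt0 (k * (T - t))).
have s0 := lt0r_neq0 (sinhc_gt0 (k * (T - t))).
rewrite /nagg_damping -/k /tanh -mul_ssinh /cothc /tanhc /ssinh /scosh.
by field; rewrite T_t c0 s0.
Qed.

(** Both sides are rational in T - t, cosh and sinhc once mu is replaced by
4 (c^2 - 1) / a^2, which is the relation c^2 - k^2 a^2 = 1 solved for mu. *)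
Lemma nagg_energyE T mu (f : 'rV[R]_n -> R) (X : R -> 'rV[R]_n) t :
  0 <= mu -> t < T ->
  let k := Num.sqrt mu / 2 in
  let Y := X t - X T in let V := velocity T X t in
  nagg_energy T mu f X t =
  energy_form mu (ssinh k (T - t)) (scosh k (T - t)) (f (X t) - f (X T))
    (dot Y Y) (dot Y V) (dot V V).
Proof.
move=> mu_ge0 tT k Y V; have T_t : T - t != 0 by rewrite subr_eq0 gt_eqF.
have c0 := lt0r_neq0 (cosh_gt0 (k * (T - t))).
have s0 := lt0r_neq0 (sinhc_gt0 (k * (T - t))).
have mu_ca : mu = 4 * (scosh k (T - t) ^+ 2 - 1) / ssinh k (T - t) ^+ 2.
  have -> : scosh k (T - t) ^+ 2 - 1 = k ^+ 2 * ssinh k (T - t) ^+ 2.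
    by apply/eqP; rewrite subr_eq [_ + 1]addrC -subr_eq scosh2_ssinh2.
  by rewrite mulrA mulfK ?expf_neq0 ?mulf_neq0// -sqr_half_sqrt.
rewrite /nagg_energy -/k !enorm_sqr -/V [X t + _ - _]addrAC -/Y.
rewrite dot_addZ /energy_form mu_ca /cschc /cothc /tanhc.
rewrite /ssinh /scosh.
by field; rewrite T_t c0 s0.
Qed.

End Nagg.

(** * Monotonicity of the energy *)

Theorem theorem19 (R : realType) (n : nat) (T mu s : R) (x0 : 'rV[R]_n)
    (f : 'rV[R]_n -> R) (X : R -> 'rV[R]_n)
    (T_gt0 : 0 < T) (mu_ge0 : 0 <= mu) (s_gt0 : 0 < s)
    (f_C1 : continuously_differentiable f)
    (f_convex : strongly_convex mu f)
    (f_smooth : smooth s^-1 f)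
    (f_min : exists xstar, forall x, f xstar <= f x)
    (X_sol : nagg_solution T mu f X x0) :
  {in `[0, T[ &, nonincreasing_fun (nagg_energy T mu f X)}.
Proof.
case: X_sol => _ DX DV ode _ _; have [diff_f _] := f_C1.
pose k := Num.sqrt mu / 2.
have mu_k : mu = 4 * k ^+ 2 by exact: sqr_half_sqrt.
pose V := velocity T X; pose Y (t : R) : 'rV[R]_n := X t - X T.
pose a (t : R) : R := ssinh k (T - t); pose c (t : R) : R := scosh k (T - t).
have a_gt0 t : t < T -> 0 < a t by move=> tT; rewrite ssinh_gt0// subr_gt0.
have c_gt0 t : 0 < c t by exact: cosh_gt0.
have DTB (t : R) : is_derive t 1 (fun u => T - u) (- 1 : R).
  have D := is_deriveB (is_derive_cst T t 1) (is_derive_id t 1).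
  by apply: is_derive_eq D _; rewrite sub0r.
have Da (t : R) : is_derive t 1 a (- c t).
  by apply: is_derive_eq (is_derive1_comp (is_derive_ssinh _ _) (DTB t)) _;
    rewrite mulrN1.
have Dc (t : R) : is_derive t 1 c (- (k ^+ 2 * a t)).
  by apply: is_derive_eq (is_derive1_comp (is_derive_scosh _ _) (DTB t)) _;
    rewrite mulrN1.
pose E (t : R) : R := energy_form (4 * k ^+ 2) (a t) (c t) (f (X t) - f (X T))
    (dot (Y t) (Y t)) (dot (Y t) (V t)) (dot (V t) (V t)).
suff Edecr : {in `[0, T[ &, {homo E : x y /~ x <= y}}.
  move=> x y xT yT xy.
  have [xltT yltT] : x < T /\ y < T by rewrite (itvP xT) (itvP yT).
  rewrite (nagg_energyE f X mu_ge0 xltT) (nagg_energyE f X mu_ge0 yltT).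
  by have := Edecr y x yT xT xy; rewrite /E -mu_k.
pose E' (t : R) : R :=
  8 * c t / a t ^+ 3 *
    (f (X t) - f (X T) - dot (grad f (X t)) (Y t)
     + 2 * k ^+ 2 * dot (Y t) (Y t))
  - 4 * k ^+ 2 / (a t * c t) * dot (V t) (V t).
have DE (t : R) : t \in `]0, T[ -> is_derive t 1 E (E' t).
  move=> t0T.
  have tA : nbhs t `[0, T[%classic.
    apply: (@filterS _ _ _ `]0, T[%classic).
      by move=> u /=; rewrite !in_itv/= => /andP[/ltW-> ->].
    by apply: open_nbhs_nbhs; split => //; exact: interval_open.
  have {}t0T : 0 <= t < T by rewrite !(itvP t0T).
  have /andP[_ tT] := t0T.
  have DXt : is_derive t 1 X (V t) := is_derive_within tA (DX t t0T).
  have DVt : is_derive t 1 V (acceleration T X t) :=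
    is_derive_within tA (DV t t0T).
  have DYt : is_derive t 1 Y (V t).
    by apply: is_derive_eq; rewrite subr0.
  have Dw : is_derive t 1 (fun u => f (X u) - f (X T))
      (dot (grad f (X t)) (V t)).
    have D := is_derive_comp_grad (diff_f (X t)) DXt.
    by apply: is_derive_eq; rewrite subr0.
  have acc : acceleration T X t =
      - nagg_damping T mu t *: V t + (-1) *: grad f (X t).
    rewrite scaleN1r scaleNr; apply/eqP.
    by rewrite -subr_eq0 opprD !opprK addrA ode.
  rewrite nagg_dampingE// -/k -/(a t) -/(c t) in acc.
  apply: (@is_derive_energy_form R k t (dot (grad f (X t)) (V t))
    (dot (grad f (X t)) (Y t)) a c (fun u => f (X u) - f (X T))
    (fun u => dot (Y u) (Y u)) (fun u => dot (Y u) (V u))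
    (fun u => dot (V u) (V u))) => //.
  - by rewrite gt_eqF// a_gt0.
  - by rewrite gt_eqF.
  - by apply: is_derive_eq (is_derive_dot DYt DYt) _;
      rewrite dotC mulr2n mulrDl !mul1r.
  - apply: is_derive_eq (is_derive_dot DYt DVt) _; rewrite acc dotDr !dotZr.
    by rewrite [dot (grad _ _) _]dotC; ring.
  - apply: is_derive_eq (is_derive_dot DVt DVt) _.
    rewrite [dot (acceleration _ _ _) _]dotC acc dotDr !dotZr.
    by rewrite [dot (grad _ _) _]dotC; ring.
apply: ler0_derive1_le_co.
- by move=> t /DE[].
- move=> t t0T; have [_ ] := DE t t0T; rewrite derive1E => ->.
  have a0 : 0 < a t by apply: a_gt0; rewrite (itvP t0T).
  have c0 := c_gt0 t.
  (* the base point is X t, so that the gradient of the equation appears *)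
  have := f_convex (X t) (X T); rewrite enorm_sqr => cvx.
  have v_ge0 : 0 <= dot (V t) (V t) by rewrite -enorm_sqr sqr_ge0.
  rewrite subr_le0 (@le_trans _ _ 0)//.
    apply: mulr_ge0_le0.
      by apply: divr_ge0; [exact: mulr_ge0 (ltW c0)|exact/exprn_ge0/ltW].
    have YN : X T - X t = (-1) *: Y t by rewrite scaleN1r opprB.
    move: cvx; rewrite YN !dotZr [dot (_ *: _) _]dotC !dotZr.
    by rewrite [in _ / 2]mu_k; lra.
  apply: mulr_ge0 v_ge0; apply: divr_ge0; first exact: mulr_ge0 (sqr_ge0 _).
  exact: mulr_ge0 (ltW a0) (ltW c0).
apply/subspace_continuousP => t /= t0T.
have tT : t < T by rewrite (itvP t0T).
have {}t0T : 0 <= t < T by rewrite !(itvP t0T).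
pose F := within `[0, T[%classic (nbhs t).
have CX : X @ F --> X t by exact: derivable_within_cvg (DX t t0T).
have CV : V @ F --> V t by exact: derivable_within_cvg (DV t t0T).
have CY : Y @ F --> Y t by apply: cvgB => //; exact: cvg_cst.
have continuous_der (g : R -> R) dg : is_derive t 1 g dg -> g @ F --> g t.
  move=> [/derivable1_diffP Dg _]; apply: cvg_within_filter.
  exact: differentiable_continuous.
apply: cvg_energy_form.
- by rewrite gt_eqF// a_gt0.
- exact: continuous_der.
- exact: continuous_der.
- apply: cvgB; last exact: cvg_cst.
  by apply: continuous_cvg => //; exact: differentiable_continuous.
- exact: cvg_dot.
- exact: cvg_dot.
- exact: cvg_dot.
Qed.
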